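(* Let the ansatz be $u(x,w)=\sum_{\ell=0}^{m-1}\sum_{d=0}^{D_\ell}a_{\ell,d}\,w_\ell x^d$ and the forcing term be $f(x,u)=\sum_{q=0}^{Q}b_q(x)u^q$ with polynomials $b_q$ of degree $B_q$, and set $D_u=\max_\ell D_\ell$, $D_f=\max_{0\le q\le Q}(B_q+qD_u)$. Let $\chi:\mathcal I_X\times\mathcal I_W\to\{0,1\}$ be the residual-threshold predicate, and assume that it is independent of the spatial index: there is a set $\mathcal M\subseteq\mathcal I_W$ such that for all $i\in\mathcal I_X$, $$\chi(i,j)=\begin{cases}1,& j\in\mathcal M,\\ 0,& j\notin\mathcal M.\end{cases}$$ Let $M:=|\mathcal M|$ with $0<M<N_W$. Then the marked parameter set $\mathcal M_i=\{j\in\mathcal I_W:\chi(i,j)=1\}$ is identical for all collocation points ($\mathcal M_i=\mathcal M$ for all $i$), and all amplification angles $\theta_i=\arcsin\sqrt{|\mathcal M_i|/N_W}$ coincide: $$\theta_i=\theta=\arcsin\left(\sqrt{\frac{M}{N_W}}\right)\qquad\text{for all } i\in\mathcal I_X.$$ Consequently, the coherent spatially conditioned amplification dynamics reduce to the standard amplitude amplification regime on $\mathcal H_W$: with $G_{\mathcal M}=U_{\Psi_W}\bigl(I_W-2\sum_{j\in\mathcal M}|j\rangle\langle j|_W\bigr)$ one has, for every $k\in\mathbb N_0$, $$G^k\bigl(|\Psi_X\rangle\otimes|\Psi\rangle_W\otimes|0\rangle_Z\otimes|0\rangle_A\bigr)=|\Psi_X\rangle\otimes G_{\mathcal M}^k|\Psi\rangle_W\otimes|0\rangle_Z\otimes|0\rangle_A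 .$$ The optimal iteration count $k^\ast=\arg\max_{k\in\mathbb N_0}P(k)$, where $P(k)=\sum_{i=0}^{N_X-1}|\alpha_i|^2\sin^2((2k+1)\theta_i)$ is the total success probability after $k$ iterations, is given by $$k^\ast=\left\lfloor\frac{\pi}{4\theta}-\frac12\right\rfloor,$$ where $\lfloor\cdot\rfloor$ denotes rounding to the nearest integer. The corresponding total gate complexity is $$C_{\mathrm{quantum}}=O\left(\frac{1}{\arcsin\left(\sqrt{M/N_W}\right)}\left(n_Zn_X^{D_f}n_W^{Q}(D_f+Q+1)^2+n_Z^2\right)\right).$$ In the sparse-marked regime $M/N_W\ll1$ one has $\arcsin(\sqrt{M/N_W})\sim\sqrt{M/N_W}$, and therefore $$C_{\mathrm{quantum}}=O\left(\sqrt{\frac{N_W}{M}}\left(n_Zn_X^{D_f}n_W^{Q}(D_f+Q+1)^2+n_Z^2\right)\right).$$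
   Context: Registers: $\mathcal H_X,\mathcal H_W,\mathcal H_Z$ are the spaces of $n_X,n_W,n_Z$ qubits with computational bases indexed by $\mathcal I_X=\{0,\dots,N_X-1\}$, $\mathcal I_W=\{0,\dots,N_W-1\}$, $\{0,\dots,N_Z-1\}$, where $N_X=2^{n_X}$, $N_W=2^{n_W}$, $N_Z=2^{n_Z}$; $\mathcal H_A$ is an ancilla space. $|i\rangle_X$ encodes a grid (collocation) point $x_i$ (grid spacing $h$), $|j\rangle_W$ a parameter vector $w_j$ (with $m$ fixed-point components, $n_W$ qubits in total), $|k\rangle_Z$ a two's-complement fixed-point number $z_k$. Predicate: $r(x,w)=D_h^2u(x,w)+f(x,u(x,w))$ with $D_h^2u(x,w)=h^{-2}(u(x-h,w)-2u(x,w)+u(x+h,w))$; for a tolerance $\varepsilon_{\mathrm{tol}}>0$, $\chi(i,j)=1$ if $|r(x_i,w_j)|<\varepsilon_{\mathrm{tol}}$ and $0$ otherwise. All residual, tolerance and comparison values are representable in the value register: there is $\kappa(i,j)$ with $z_{\kappa(i,j)}=|r(x_i,w_j)|-\varepsilon_{\mathrm{tol}}$. Operators: $U_c$ is a unitary with $U_c|i\rangle_X|j\rangle_W|0\rangle_Z|0\rangle_A=|i\rangle_X|j\rangle_W|\kappa(i,j)\rangle_Z|\varphi(i,j)\rangle_A$ for some ancilla states $|\varphi(i,j)\rangle_A$; $S_Z|k\rangle_Z=(-1)^{\mathbf 1[z_k<0]}|k\rangle_Z$; $S_\chi=U_c^\dagger(I_X\otimes I_W\otimes S_Z\otimes I_A)U_c$,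 so $S_\chi|i\rangle_X|j\rangle_W|0\rangle_Z|0\rangle_A=(-1)^{\chi(i,j)}|i\rangle_X|j\rangle_W|0\rangle_Z|0\rangle_A$. $|\Psi_X\rangle=\sum_i\alpha_i|i\rangle_X$ is a unit vector, $|\Psi\rangle_W=N_W^{-1/2}\sum_j|j\rangle_W$, $U_{\Psi_W}=2|\Psi\rangle\langle\Psi|_W-I_W$, and the amplification iterate is $G=(I_X\otimes U_{\Psi_W}\otimes I_Z\otimes I_A)S_\chi$. The amplification process applies $G^k$ to $|\Psi_X\rangle\otimes|\Psi\rangle_W\otimes|0\rangle_Z\otimes|0\rangle_A$; in the spatial sector $i$ the probability of measuring a marked parameter $j\in\mathcal M_i$ is $\sin^2((2k+1)\theta_i)$. Complexity: elementary gates are arbitrary one-qubit gates and CNOTs. The total gate complexity $C_{\mathrm{quantum}}$ is that of performing $k^\ast$ amplification iterations, each using one residual-threshold oracle; the residual-threshold oracle ($S_\chi$ conjugated by the spatial state-preparation unitary $U_{\mathrm{sup},X}$, $U_{\mathrm{sup},X}|0\rangle_X=|\Psi_X\rangle$), implemented by QFT-based reversible polynomial arithmetic, has elementary gate complexity $C_{\mathrm{oracle}}=O\bigl(n_Zn_X^{D_f}n_W^{Q}(D_f+Q+1)^2+n_Z^2\bigr)$. As for the oracle estimate, complexities are up to lower-order polynomial overhead (finite-difference shifts, comparison, phase marking, uncomputation).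
   Formalization: The argmax over all k may not exist (e.g. M/N_W=1/8), so k* maximizes P over (2k+1)θ≤π; if the argmax over all k exists, it contains the nearest integers. Reflection gates count in C_quantum only if O(oracle bound); otherwise only oracle gates are bounded. *)

(* Defs.v *)
From HB Require Import structures.
From mathcomp Require Import all_boot all_order all_algebra.
From mathcomp Require Import all_classical all_reals all_analysis.
From mathcomp Require Import complex mxtens.

Set Implicit Arguments.
Unset Strict Implicit.
Unset Printing Implicit Defensive.

Import Order.TTheory GRing.Theory Num.Theory.
Import numFieldNormedType.Exports Normc.
Local Open Scope classical_set_scope.
Local Open Scope complex_scope.
Local Open Scope sesquilinear_scope.
Local Open Scope ring_scope.

Section Kets.
Variable R : realType.

Definition ket (N : nat) (i : 'I_N) : 'cV[R[i]]_N := delta_mx i 0.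

Definition ket0 (n : nat) : 'cV[R[i]]_(2 ^ n) :=
  @ket (2 ^ n) (Ordinal (expn_gt0 2 n)).

Definition sqnorm (N : nat) (v : 'cV[R[i]]_N) : R := \sum_s normc (v s 0) ^+ 2.

(* Register order X, W, Z, A; [tensmx] makes the leftmost factor the most
   significant part of the composite index. *)
Definition kron4 (a b c d a' b' c' d' : nat)
    (A : 'M[R[i]]_(a, a')) (B : 'M[R[i]]_(b, b'))
    (C : 'M[R[i]]_(c, c')) (D : 'M[R[i]]_(d, d')) :
    'M[R[i]]_(a * b * c * d, a' * b' * c' * d') :=
  tensmx (tensmx (tensmx A B) C) D.

End Kets.

Definition twos_complement (R : realType) (n frac k : nat) : R :=
  (if (k < 2 ^ n.-1)%N then k%:R else k%:R - 2 ^+ n) / 2 ^+ frac.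

Section Residual.
Variable R : realType.

Definition ansatz (m : nat) (D : 'I_m -> nat) (a : 'I_m -> nat -> R)
    (x : R) (w : 'I_m -> R) : R :=
  \sum_(l < m) \sum_(d < (D l).+1) a l d * w l * x ^+ d.

Definition forcing (Q : nat) (b : nat -> {poly R}) (x v : R) : R :=
  \sum_(q < Q.+1) (b q).[x] * v ^+ q.

Definition second_difference (V : Type) (h : R) (u : R -> V -> R)
    (x : R) (w : V) : R :=
  (u (x - h) w - 2 * u x w + u (x + h) w) / h ^+ 2.

Definition residual (V : Type) (h : R) (u : R -> V -> R) (f : R -> R -> R)
    (x : R) (w : V) : R :=
  second_difference h u x w + f x (u x w).

End Residual.

Record model (R : realType) := Model {
  nX : nat; nW : nat; nZ : nat; nA : nat;
  grid0 : R; step : R; step_gt0 : 0 < step;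
  nparam : nat; xdeg : 'I_nparam -> nat; ucoef : 'I_nparam -> nat -> R;
  udeg : nat; fcoef : nat -> {poly R};
  (* the parameter vector encoded by |j>; no particular number encoding is imposed *)
  wpar : 'I_(2 ^ nW) -> 'I_nparam -> R;
  tol : R; tol_gt0 : 0 < tol;
  (* number of fractional bits of the value register *)
  fracZ : nat;
  u_ := ansatz xdeg ucoef;
  f_ := forcing udeg fcoef;
  res (i : 'I_(2 ^ nX)) (j : 'I_(2 ^ nW)) :=
    residual step u_ f_ (grid0 + i%:R * step) (wpar j);
  zval (k : 'I_(2 ^ nZ)) := twos_complement R nZ fracZ k;
  kappa : 'I_(2 ^ nX) -> 'I_(2 ^ nW) -> 'I_(2 ^ nZ);
  kappaP : forall i j, zval (kappa i j) = `|res i j| - tol;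
  Uc : 'M[R[i]]_(2 ^ nX * 2 ^ nW * 2 ^ nZ * 2 ^ nA);
  Uc_unitary : Uc \is unitarymx;
  Uc_compute : forall i j, exists phi : 'cV[R[i]]_(2 ^ nA),
    Uc *m kron4 (ket R i) (ket R j) (ket0 R nZ) (ket0 R nA) =
    kron4 (ket R i) (ket R j) (ket R (kappa i j)) phi;
  alpha : 'I_(2 ^ nX) -> R[i];
  PsiX := \sum_i alpha i *: ket R i;
  PsiX_unit : sqnorm PsiX = 1;
  UsupX : 'M[R[i]]_(2 ^ nX);
  UsupX_unitary : UsupX \is unitarymx;
  UsupX_prepare : UsupX *m ket0 R nX = PsiX }.

Section Amplification.
Variables (R : realType) (p : model R).

Local Notation NX := (2 ^ nX p)%N.
Local Notation NW := (2 ^ nW p)%N.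
Local Notation NZ := (2 ^ nZ p)%N.
Local Notation NA := (2 ^ nA p)%N.
Local Notation operator := 'M[R[i]]_(NX * NW * NZ * NA).

Definition chi (i : 'I_NX) (j : 'I_NW) : bool := `|res i j| < tol p.

Definition marked (i : 'I_NX) : {set 'I_NW} := [set j | chi i j]%SET.

Definition theta (i : 'I_NX) : R := asin (Num.sqrt (#|marked i|%:R / NW%:R)).

Definition SZ : 'M[R[i]]_NZ := diag_mx (\row_k (-1) ^+ (zval k < 0)%R).

Definition Schi : operator :=
  (Uc p) ^t* *m kron4 1%:M 1%:M SZ 1%:M *m Uc p.

Definition PsiW : 'cV[R[i]]_NW :=
  ((Num.sqrt NW%:R : R)%:C)^-1 *: \sum_j ket R j.

Definition UPsiW : 'M[R[i]]_NW := 2 *: (PsiW *m PsiW ^t*) - 1%:M.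

Definition diffusion : operator := kron4 1%:M UPsiW 1%:M 1%:M.

Definition Giter : operator := diffusion *m Schi.

Definition GM (MM : {set 'I_NW}) : 'M[R[i]]_NW :=
  UPsiW *m (1%:M - 2 *: \sum_(j in MM) ket R j *m (ket R j) ^t*).

Definition amplified (k : nat) : 'cV[R[i]]_(NX * NW * NZ * NA) :=
  Giter ^+ k *m kron4 (PsiX p) PsiW (ket0 R (nZ p)) (ket0 R (nA p)).

Definition marked_projector : operator :=
  \sum_i \sum_(j in marked i)
    kron4 (ket R i *m (ket R i) ^t*) (ket R j *m (ket R j) ^t*) 1%:M 1%:M.

Definition Psucc (k : nat) : R :=
  \sum_i normc (alpha i) ^+ 2 * sin ((2 * k + 1)%N%:R * theta i) ^+ 2.

Definition conj_sup (U : operator) : operator :=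
  kron4 ((UsupX p) ^t*) 1%:M 1%:M 1%:M *m U *m kron4 (UsupX p) 1%:M 1%:M 1%:M.

Definition oracle : operator := conj_sup Schi.

Definition Du : nat := (\max_(l < nparam p) xdeg l)%N.

(* [(size q).-1] is the degree of q, with the zero polynomial of degree 0. *)
Definition Df : nat := (\max_(q < (udeg p).+1) ((size (fcoef p q)).-1 + q * Du))%N.

Definition oracle_bound : nat :=
  (nZ p * nX p ^ Df * nW p ^ udeg p * (Df + udeg p + 1) ^ 2 + nZ p ^ 2)%N.

End Amplification.

Section Rounding.
Variable R : realType.

(* A domain S is needed: over all of nat the success probability approaches its
   supremum without attaining it as soon as theta / pi is irrational. *)
Definition argmax_on (S : set nat) (F : nat -> R) : set nat :=
  [set k | S k /\ forall l, S l -> F l <= F k].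

(* Both neighbours qualify when x is a half-integer. *)
Definition nearest (x : R) (k : nat) : Prop := `|k%:R - x| <= 2^-1.

End Rounding.

Section Circuits.
Variable R : realType.

(* Qubit q is the bit of weight 2 ^ q of the composite basis index. *)
Inductive gate :=
  | OneQubit of nat & 'M[R[i]]_2
  | CNOT of nat & nat.

Definition bit (q s : nat) : bool := odd (s %/ 2 ^ q)%N.

Definition flip (q s : nat) : nat := (if bit q s then s - 2 ^ q else s + 2 ^ q)%N.

Definition gate_ok (n : nat) (e : gate) : bool :=
  match e with
  | OneQubit q g => (q < n)%N && (g \is unitarymx)
  | CNOT c t => [&& (c < n)%N, (t < n)%N & c != t]
  end.

Definition gate_mx (N : nat) (e : gate) : 'M[R[i]]_N :=
  match e with
  | OneQubit q g => \matrix_(s, s')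
      if (s %/ 2 ^ q.+1 == s' %/ 2 ^ q.+1)%N && (s %% 2 ^ q == s' %% 2 ^ q)%N
      then g (inord (bit q s)) (inord (bit q s')) else 0
  | CNOT c t => \matrix_(s, s')
      ((s : nat) == if bit c s' then flip t s' else s')%:R
  end.

(* The head of the list is applied first. *)
Fixpoint circuit_mx (N : nat) (c : seq gate) : 'M[R[i]]_N :=
  if c is e :: c' then circuit_mx N c' *m gate_mx N e else 1%:M.

Definition implements (p : model R) (c : seq gate)
    (U : 'M[R[i]]_(2 ^ nX p * 2 ^ nW p * 2 ^ nZ p * 2 ^ nA p)) : Prop :=
  all (gate_ok (nX p + nW p + nZ p + nA p)) c /\ circuit_mx _ c = U.

Definition amplification_circuit (oracle_circ diffusion_circ : seq gate)
    (k : nat) : seq gate :=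
  flatten (nseq k (oracle_circ ++ diffusion_circ)).

End Circuits.

(* Main.v *)
(* Since the marked set does not depend on the spatial index, the phase oracle
   acts on Psi_X (x) v (x) 0 (x) 0 as the reflection of v about the unmarked
   subspace, so that the iterate is the usual rotation by 2 theta in the plane
   spanned by the marked and the unmarked uniform states.  Writing
   y_k = (2k+1) theta and x = pi/(4 theta) - 1/2, one has
   |y_k - pi/2| = 2 theta |k - x|, and on [0, pi] the function sin^2 decreases
   with the distance to pi/2: on the first cycle, maximizing is rounding x.

   Over all k, sin^2 theta = s/2^g in lowest terms.  For g >= 3, all the numbers
   2 cos(2 n theta) with n >= 1 have an odd numerator over a proper power of 2,
   so 2 theta is not commensurable with pi, multiples of 2 theta come arbitrarily
   close to multiples of pi, and no maximum is attained.  The cases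
   s/2^g = 1/2, 1/4, 3/4 have maxima 1/2, 1, 3/4, all reached in the first cycle.

   The complexity bounds follow from k* <= 1/theta and
   theta = arcsin(sqrt(M/N)) >= sqrt(M/N). *)
Require Import Defs.
From HB Require Import structures.
From mathcomp Require Import all_boot all_order all_algebra.
From mathcomp Require Import all_classical all_reals all_analysis.
From mathcomp Require Import complex mxtens.
From mathcomp Require Import zify ring lra.

Set Implicit Arguments.
Unset Strict Implicit.
Unset Printing Implicit Defensive.

Import Order.TTheory GRing.Theory Num.Theory.
Import numFieldNormedType.Exports Normc.
Local Open Scope classical_set_scope.
Local Open Scope complex_scope.
Local Open Scope sesquilinear_scope.
Local Open Scope ring_scope.

(** * Maximizing the squared sine over odd multiples of an angle *)

(** Here [sin w] is the cosine of the distance from [w] to pi / 2; this distance is at most pi / 2,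
    where the cosine is nonnegative and decreasing. *)
Lemma ler_sin_sqr (R : realType) (y z : R) : 0 <= y <= pi -> 0 <= z <= pi ->
  (sin z ^+ 2 <= sin y ^+ 2) = (`|y - pi / 2| <= `|z - pi / 2|).
Proof.
have dist_le (w : R) : 0 <= w <= pi -> `|w - pi / 2| <= pi / 2.
  by move=> /andP[w0 wpi]; rewrite ler_norml; apply/andP; split; lra.
have pi0 := pi_gt0 R.
have in0pi (w : R) : 0 <= w <= pi -> `|w - pi / 2| \in `[0, pi].
  move=> /dist_le w_le; rewrite in_itv /= normr_ge0 /=.
  by apply: (le_trans w_le); lra.
have sin_dist (w : R) : sin w = cos `|w - pi / 2| by rewrite cos_norm cosBpihalf.
have cos_dist_ge0 (w : R) : 0 <= w <= pi -> 0 <= cos `|w - pi / 2|.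
  by rewrite -sin_dist; exact: sin_ge0_pi.
move=> y_itv z_itv; rewrite !sin_dist ler_sqr ?nnegrE ?cos_dist_ge0 //.
by rewrite leNgt ltr_cos ?in0pi // -leNgt.
Qed.

Lemma argmax_first_cycle (R : realType) (th : R) (k : nat) : 0 < th < pi / 2 ->
  argmax_on [set l : nat | (2 * l + 1)%N%:R * th <= pi]
    (fun l => sin ((2 * l + 1)%N%:R * th) ^+ 2) k <->
  nearest (pi / (4 * th) - 2^-1) k.
Proof.
move=> /andP[th0 th_lt]; set x := pi / (4 * th) - 2^-1.
have dist l : `|(2 * l + 1)%N%:R * th - pi / 2| = 2 * th * `|l%:R - x|.
  rewrite -[2 * th in RHS]gtr0_norm ?mulr_gt0 // -normrM; congr `| _ |.
  by rewrite /x natrD natrM; field; rewrite gt_eqF.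
have angle_ge0 l : 0 <= (2 * l + 1)%N%:R * th by rewrite mulr_ge0 // ltW.
have angle_itv l : (2 * l + 1)%N%:R * th <= pi -> 0 <= (2 * l + 1)%N%:R * th <= pi.
  by rewrite angle_ge0.
have x_gt0 : 0 < x.
  rewrite /x subr_gt0 ltr_pdivlMr ?mulr_gt0 //; lra.
(* Rounding puts the angle within [th] of pi / 2, and [th] is below pi / 2, so rounding never leaves
   the first cycle. *)
have near_cycle l : nearest x l -> (2 * l + 1)%N%:R * th <= pi.
  rewrite /nearest => near_l.
  have := ler_wpM2l (ltW (mulr_gt0 (ltr0Sn R 1) th0)) near_l.
  rewrite -dist mulrAC divff ?pnatr_eq0 // mul1r ler_norml => /andP[_]; lra.
have le_dist l m : (`|(2 * l + 1)%N%:R * th - pi / 2| <=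
    `|(2 * m + 1)%N%:R * th - pi / 2|) = (`|l%:R - x| <= `|m%:R - x|).
  by rewrite !dist ler_pM2l // mulr_gt0.
split=> [[/= k_cycle k_max]|near_k].
  have [l near_l] : exists l, nearest x l.
    exists (Num.truncn (x + 2^-1)); rewrite /nearest.
    have x2_ge0 : 0 <= x + 2^-1 by lra.
    have /andP[] := truncn_itv x2_ge0.
    rewrite -(natr1 (Num.truncn _)) ler_norml => *; apply/andP; split; lra.
  have := k_max l (near_cycle l near_l).
  rewrite ler_sin_sqr ?(angle_itv, near_cycle l near_l) // le_dist => /le_trans; exact.
split=> [|l /= l_cycle]; first exact: near_cycle.
rewrite ler_sin_sqr ?(angle_itv, near_cycle k near_k) // le_dist leNgt; apply/negP => l_lt.
(* If [l] were strictly closer to [x] than [k], two integers within 1/2 of [x], one of them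
   strictly, would be less than 1 apart, hence equal. *)
have : `|l%:R - k%:R : R| < 1.
  rewrite (_ : l%:R - k%:R = (l%:R - x) - (k%:R - x)); last by ring.
  by apply: le_lt_trans (ler_normB _ _) _; move: near_k l_lt; rewrite /nearest; lra.
rewrite ltr_norml => /andP[lk_gt lk_lt].
suff lk : l = k by move: l_lt; rewrite lk ltxx.
apply/eqP; rewrite eqn_leq -[(l <= k)%N]ltnS -[(k <= l)%N]ltnS -!(ltr_nat R) -(natr1 l) -(natr1 k).
by apply/andP; split; lra.
Qed.

(** * Arithmetic of the cosines of multiples of an angle *)

Lemma cosSS (R : realType) (x : R) (n : nat) :
  cos (n.+2%:R * x) = 2 * cos x * cos (n.+1%:R * x) - cos (n%:R * x).
Proof.
rewrite (_ : n.+2%:R * x = n.+1%:R * x + x); last by rewrite -natr1 mulrDl mul1r.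
rewrite (_ : n%:R * x = n.+1%:R * x - x); last by rewrite -natr1 mulrDl mul1r addrK.
by rewrite cosD cosB; ring.
Qed.

(* The numerators satisfy the Chebyshev recurrence, which preserves oddness. *)
Lemma odd_dyadic_cos (R : realType) (x : R) (e : nat) (b : int) :
  2 * cos x * 2 ^+ e.+1 = (2 * b + 1)%:~R ->
  forall n, exists c : int, 2 * cos (n.+1%:R * x) * 2 ^+ (e.+1 * n.+1) = (2 * c + 1)%:~R.
Proof.
move=> cosx n.
(* The recurrence reaches back two terms, so the induction carries two. The older one is only an
   integer, because n = 0 gives the even value 2. *)
suff [] : (exists a : int, 2 * cos (n%:R * x) * 2 ^+ (e.+1 * n) = a%:~R) /\
  (exists c : int, 2 * cos (n.+1%:R * x) * 2 ^+ (e.+1 * n.+1) = (2 * c + 1)%:~R) by [].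
elim: n => [|n [[a cos_a] [c cos_c]]].
  split; last by exists b; rewrite muln1 mul1r.
  by exists 2; rewrite mul0r cos0 muln0 expr0 !mulr1.
split; first by exists (2 * c + 1).
(* Half of (2b + 1)(2c + 1) - 4 * 4^e * a - 1. *)
exists (2 * b * c + b + c - 2 * 4 ^+ e * a).
rewrite cosSS (_ : _ * _ = 2 * cos x * 2 ^+ e.+1 *
  (2 * cos (n.+1%:R * x) * 2 ^+ (e.+1 * n.+1)) -
  4 * 4 ^+ e * (2 * cos (n%:R * x) * 2 ^+ (e.+1 * n))).
  have -> : 4 ^+ e = (4 ^+ e)%:~R :> R by rewrite rmorphXn.
  by rewrite cosx cos_c cos_a; move: (4 ^+ e : int) => q; ring.
rewrite (_ : 4 = 2 ^+ 2 :> R); last by ring.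
rewrite -exprM (_ : (e.+1 * n.+2 = e.+1 + (e.+1 * n.+1))%N); last by lia.
rewrite (_ : (e.+1 * n.+1 = e.+1 + (e.+1 * n))%N); last by lia.
move: (e.+1 * n)%N => m; rewrite mul2n -addnn !exprD !exprS.
by move: (2 ^+ m) (2 ^+ e) => p q; ring.
Qed.

(** A zero sine forces cosine 1 or -1; squaring the identity of [odd_dyadic_cos] would then equate a
    multiple of 4 with an odd square. *)
Lemma sin_odd_dyadic_neq0 (R : realType) (x : R) (e : nat) (b : int) :
  2 * cos x * 2 ^+ e.+1 = (2 * b + 1)%:~R -> forall n, sin (n.+1%:R * x) != 0.
Proof.
move=> /odd_dyadic_cos cosx n; have [c cos_c] := cosx n.
apply/eqP => sin0; move: (congr1 (fun y => y ^+ 2) cos_c).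
rewrite !exprMn cos2sin2 sin0 expr0n subr0 mulr1.
have -> : 2 ^+ 2 * (2 ^+ (e.+1 * n.+1)) ^+ 2 = (4 * (2 ^+ (e.+1 * n.+1)) ^+ 2)%:~R :> R.
  by rewrite !(rmorphM, rmorphXn) /=; ring.
have -> : (2 * c + 1)%:~R ^+ 2 = ((2 * c + 1) ^+ 2)%:~R :> R by rewrite rmorphXn.
move=> /intr_inj.
move: (_ ^+ 2 : int) => q; nia.
Qed.

(* Dirichlet: two of the points (cos jx, sin jx) fall into the same cell of a
   fine grid, and sin (j' - j)x is their determinant. *)
Lemma small_sin_multiple (R : realType) (x eps : R) : 0 < eps ->
  exists d : nat, `|sin (d.+1%:R * x)| <= eps.
Proof.
(* The determinant below has two error terms of size at most 1 / K, whence 2 / K <= eps. *)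
move=> eps0; pose K := (Num.truncn (2 / eps)).+1.
have K0 : 0 < K%:R :> R by rewrite ltr0n.
have K_eps : 2 / K%:R <= eps.
  by rewrite ler_pdivrMr // -ler_pdivrMl // mulrC ltW // truncnS_gt.
(* Cells of width 1 / K on [-1, 1]; index 2K serves y = 1 alone, so [inord] never falls back to its
   default. *)
pose cell (y : R) : 'I_(2 * K).+1 := inord (Num.truncn (K%:R * (1 + y))).
have cell_close y z : -1 <= y <= 1 -> -1 <= z <= 1 -> cell y = cell z ->
    `|y - z| <= K%:R^-1.
  have cellE w : -1 <= w <= 1 -> cell w = Num.truncn (K%:R * (1 + w)) :> nat.
    move=> /andP[w1 w2]; rewrite inordK // ltnS.
    rewrite -ltnS truncn_lt_nat ?mulr_ge0 //; last by lra.
    apply: (@le_lt_trans _ _ (2 * K)%:R); last by rewrite ltr_nat.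
    by rewrite natrM mulrC ler_wpM2r //; lra.
  have cell_itv w : -1 <= w <= 1 -> (cell w)%:R <= K%:R * (1 + w) < (cell w)%:R + 1.
    move=> w_itv; rewrite cellE // natr1 truncn_itv // mulr_ge0 ?ler0n //; lra.
  move=> /cell_itv + /cell_itv + yz; rewrite yz => /andP[y1 y2] /andP[z1 z2].
  rewrite -[_^-1]mul1r ler_pdivlMr // -[K%:R]gtr0_norm // -normrM ler_norml.
  by apply/andP; split; lra.
pose f (j : 'I_(#|{: 'I_(2 * K).+1 * 'I_(2 * K).+1}|).+1) :=
  (cell (cos (j%:R * x)), cell (sin (j%:R * x))).
have [j [j' [jj' [ccos csin]]]] : exists j j' : 'I__, (j < j')%N /\ f j = f j'.
  have /injectivePn[j [j' jj' fjj']] : ~~ injectiveb f.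
    by apply/injectiveP => /leq_card; rewrite card_ord ltnn.
  have [lt|lt|/val_inj eq] := ltngtP j j'; last by rewrite eq eqxx in jj'.
    by exists j, j'.
  by exists j', j.
have trig_itv (y : R) : (-1 <= cos y <= 1) /\ (-1 <= sin y <= 1).
  by rewrite cos_geN1 cos_le1 sin_geN1 sin_le1.
have dcos := cell_close _ _ (trig_itv _).1 (trig_itv _).1 ccos.
have dsin := cell_close _ _ (trig_itv _).2 (trig_itv _).2 csin.
exists (j' - j).-1; rewrite prednK ?subn_gt0 // natrB 1?ltnW // mulrBl sinB.
set c := cos (j%:R * x) in dcos *; set s := sin (j%:R * x) in dsin *.
rewrite (_ : _ - _ = (c - cos (j'%:R * x)) * s - (s - sin (j'%:R * x)) * c); last by ring.
apply: le_trans (ler_normB _ _) _; rewrite !normrM.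
apply: le_trans K_eps; rewrite (_ : 2 / _ = K%:R^-1 + K%:R^-1); last by ring.
apply: lerD.
  by rewrite -[leRHS]mulr1 ler_pM // sin_max.
by rewrite -[leRHS]mulr1 ler_pM // cos_max.
Qed.

(* Rotating an odd multiple y of x by 2z or -2z, for z a multiple of x, gives up
   to sign an odd multiple again; when |sin z| is small and nonzero, one of the
   two rotations decreases the cosine. *)
Lemma cos_odd_multiple_no_min (R : realType) (x : R) (k : nat) :
  (forall n, sin (n.+1%:R * x) != 0) ->
  exists l : nat, cos ((2 * l + 1)%N%:R * x) < cos ((2 * k + 1)%N%:R * x).
Proof.
move=> sin_neq0; apply/not_existsP => no_l.
set y := (2 * k + 1)%N%:R * x in no_l.
have y_min l : cos y <= cos ((2 * l + 1)%N%:R * x) by rewrite leNgt; apply/negP.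
have siny : 0 < `|sin y| by rewrite normr_gt0 /y addn1.
have [d] := small_sin_multiple x (divr_gt0 siny (ltr0Sn R 1)).
move: (sin_neq0 d); set z := d.+1%:R * x => sinz z_small.
have plus : cos y <= cos (y + z *+ 2).
  suff -> : y + z *+ 2 = (2 * (k + d.+1) + 1)%N%:R * x by [].
  by rewrite /y /z !(natrD, natrM); ring.
have minus : cos y <= cos (y - z *+ 2).
  have [dk|kd] := leqP d.+1 k.
    suff -> : y - z *+ 2 = (2 * (k - d.+1) + 1)%N%:R * x by [].
    by rewrite /y /z !(natrD, natrM) natrB //; ring.
  (* Here the rotation passes zero and yields the negative of an odd multiple, with the same
     cosine. *)
  suff -> : y - z *+ 2 = - ((2 * (d - k) + 1)%N%:R * x) by rewrite cosN.
  by rewrite /y /z !(natrD, natrM) natrB // -natr1; ring.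
move: plus minus; rewrite cosD cosB cos_mulr2n sin_mulr2n cos2sin2.
have := cos2sin2 z; have := cos2sin2 y.
have : sin z ^+ 2 <= sin y ^+ 2 / 4.
  have := ler_pM (normr_ge0 _) (normr_ge0 _) z_small z_small.
  by rewrite -!expr2 expr_div_n !real_normK ?num_real // -natrX.
have : 0 < sin z ^+ 2 by rewrite exprn_even_gt0.
have : 0 < sin y ^+ 2 by rewrite exprn_even_gt0 // -normr_gt0.
set cy := cos y; set sy := sin y; set cz := cos z; set sz := sin z.
move=> sy2 sz2 small cy2 cz2 plus minus.
(* [plus] and [minus] together bound |sz cz sy| by - sz^2 cy. Squaring and cancelling sz^2 leaves
   cz^2 sy^2 <= sz^2 cy^2, that is sy^2 <= sz^2, against [small]. *)
have : (sz * cz * sy) ^+ 2 <= (sz ^+ 2 * cy) ^+ 2.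
  have cy_neg : 0 <= - (sz ^+ 2 * cy) by lra.
  rewrite -[leRHS]sqrrN -[leLHS]real_normK ?num_real //.
  rewrite ler_sqr ?nnegrE // ler_norml; apply/andP; split; lra.
rewrite (_ : (sz * cz * sy) ^+ 2 = sz ^+ 2 * (cz ^+ 2 * sy ^+ 2)); last by ring.
rewrite (_ : (sz ^+ 2 * cy) ^+ 2 = sz ^+ 2 * (sz ^+ 2 * cy ^+ 2)); last by ring.
rewrite ler_pM2l // cz2 cy2; nra.
Qed.

Lemma sin_sqr_double (R : realType) (x : R) : sin x ^+ 2 = (1 - cos (2 * x)) / 2.
Proof. by rewrite mulr_natl cos_mulr2n sin2cos2; field. Qed.

(** Under the recurrence, pairs of consecutive cosines cycle with period three through the values 1
    and -1/2. *)
Lemma cos_multiple_lb (R : realType) (x : R) (n : nat) :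
  cos x = - 2^-1 -> - 2^-1 <= cos (n%:R * x).
Proof.
move=> cosx; suff : [\/ cos (n%:R * x) = 1 /\ cos (n.+1%:R * x) = - 2^-1,
    cos (n%:R * x) = - 2^-1 /\ cos (n.+1%:R * x) = - 2^-1 |
    cos (n%:R * x) = - 2^-1 /\ cos (n.+1%:R * x) = 1].
  by case=> -[-> _]; lra.
elim: n => [|n]; first by rewrite mul0r mul1r cos0; constructor 1.
rewrite cosSS cosx => -[] [-> ->]; [constructor 2|constructor 3|constructor 1];
  split=> //; lra.
Qed.

Lemma cos_odd_multiple_eq0 (R : realType) (x : R) (n : nat) :
  cos x = 0 -> cos ((2 * n + 1)%N%:R * x) = 0.
Proof.
move=> cosx; elim: n => [|n IH]; first by rewrite mul1r.
by rewrite mulnS -addnA cosSS cosx IH mulr0 mul0r subr0.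
Qed.

(** A global bound reached inside the first cycle is also reached by every maximizer over that
    cycle. *)
Lemma argmax_setT_bound (R : realType) (th c : R) (k0 k : nat) : 0 < th < pi / 2 ->
  let P l := sin ((2 * l + 1)%N%:R * th) ^+ 2 in
  (forall l, P l <= c) -> (2 * k0 + 1)%N%:R * th <= pi -> P k0 = c ->
  argmax_on [set l : nat | (2 * l + 1)%N%:R * th <= pi] P k -> argmax_on setT P k.
Proof.
move=> th_itv P P_le k0_cycle Pk0 [_ k_max]; split=> // l _.
by apply: (le_trans (P_le l)); rewrite -Pk0; exact: k_max.
Qed.

(* With s odd, s / 2 ^ g is the reduced form of the squared sine; by Niven's
   theorem the angle is then commensurable with pi only for g <= 2. *)
Lemma argmax_first_cycle_setT (R : realType) (th : R) (s g k : nat) :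
  0 < th < pi / 2 -> odd s -> (s < 2 ^ g)%N -> sin th ^+ 2 = s%:R / 2 ^+ g ->
  let P l := sin ((2 * l + 1)%N%:R * th) ^+ 2 in
  argmax_on setT P !=set0 ->
  argmax_on [set l : nat | (2 * l + 1)%N%:R * th <= pi] P k -> argmax_on setT P k.
Proof.
move=> th_itv s_odd s_lt sin_th P P_max.
have /andP[th0 th_lt] := th_itv.
have PE l : P l = (1 - cos ((2 * l + 1)%N%:R * (2 * th))) / 2.
  by rewrite /P sin_sqr_double mulrCA.
have cos2th : cos (2 * th) = 1 - 2 * (s%:R / 2 ^+ g).
  by rewrite -sin_th sin_sqr_double; field.
have k0_cycle : (2 * 0 + 1)%N%:R * th <= pi by rewrite mul1r; lra.
case: g => [|[|[|g]]] in s_lt sin_th cos2th.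
- by move: s_odd s_lt; case: (s).
(* Angle pi / 4: the success probability is constantly 1/2. *)
- have s1 : s = 1%N by move: s_odd s_lt; case: (s) => [|[|]].
  have cos0 : cos (2 * th) = 0 by rewrite cos2th s1; field.
  by apply: (@argmax_setT_bound _ _ 2^-1 0) => // [l|];
    rewrite -/(P _) PE (cos_odd_multiple_eq0 _ cos0) subr0 div1r.
(* Angle pi / 6 reaches probability 1 at k = 1; angle pi / 3 never exceeds its initial value 3/4. *)
- have [s1|s3] : s = 1%N \/ s = 3 by move: s_odd s_lt; case: (s) => [|[|[|[|]]]]; auto.
    have sin_half : sin th = 2^-1.
      have sin_ge0 : 0 <= sin th by apply: sin_ge0_pi; apply/andP; split; lra.
      apply/eqP; rewrite -(@eqrXn2 _ 2) //; apply/eqP.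
      by rewrite sin_th s1; field.
    have sin3 : sin (3 * th) = 1.
      rewrite (_ : 3 * th = th *+ 2 + th); last by ring.
      rewrite sinD sin_mulr2n cos_mulr2n.
      rewrite (_ : _ + _ = sin th * (4 * cos th ^+ 2 - 1)); last by ring.
      by rewrite cos2sin2 sin_half; field.
    have th3_le : 3 * th <= pi.
      rewrite leNgt; apply/negP => th3.
      have : 0 < sin (3 * th - pi) by apply: sin_gt0_pi; apply/andP; split; lra.
      by rewrite sinB sinpi cospi sin3 mulr0 subr0 mulrN1; lra.
    by apply: (@argmax_setT_bound _ _ 1 1) => //; rewrite sin3 expr1n.
  have cos_half : cos (2 * th) = - 2^-1 by rewrite cos2th s3; field.
  apply: (@argmax_setT_bound _ _ (3 / 4) 0) => // [l|]; rewrite -/(P _) PE.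
    by have := cos_multiple_lb (2 * l + 1) cos_half; lra.
  by rewrite mul1r cos_half; field.
have [l [_ l_max]] := P_max; exfalso.
have [b cos_b] : exists b : int, 2 * cos (2 * th) * 2 ^+ g.+1 = (2 * b + 1)%:~R.
  (* The exponent is now g + 3, so the left side is 2^(g+2) - s, which is odd because [s] is. *)
  exists (2 ^+ g.+1 - (s./2)%:Z - 1).
  have sE : s%:R = 1 + 2 * (s./2)%:R :> R.
    by rewrite -{1}(odd_double_half s) s_odd natrD -mul2n natrM.
  rewrite cos2th sE !(intrD, intrM, intrN) rmorphXn /= !exprS.
  by field; rewrite expf_neq0.
have [m] := cos_odd_multiple_no_min l (sin_odd_dyadic_neq0 cos_b).
by have := l_max m I; rewrite !PE; lra.
Qed.

(** Cancels the full power of 2 in [M] to put M / 2^n in lowest terms; [M] < 2^n makes that power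
    smaller than 2^n, so the subtraction n - f is exact. *)
Lemma odd_part (M n : nat) : (0 < M < 2 ^ n)%N ->
  exists s g, [/\ odd s, (s < 2 ^ g)%N & (M * 2 ^ g = s * 2 ^ n)%N].
Proof.
move=> /andP[M0 M_lt].
pose f := logn 2 M; exists (M %/ 2 ^ f)%N, (n - f)%N.
have ME : M = (M %/ 2 ^ f * 2 ^ f)%N by rewrite divnK // pfactor_dvdnn.
have f_lt : (f < n)%N.
  rewrite -(ltn_exp2l _ _ (ltnSn 1)); apply: leq_ltn_trans M_lt.
  by rewrite dvdn_leq // pfactor_dvdnn.
have nE : (2 ^ n = 2 ^ (n - f) * 2 ^ f)%N by rewrite -expnD subnK // ltnW.
split.
- have [m m_odd Mm] := pfactor_coprime (isT : prime 2) M0.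
  by rewrite /f {1}Mm mulnK ?expn_gt0 // -coprime2n.
- by rewrite -(ltn_pmul2r (expn_gt0 2 f)) -ME -nE.
- by rewrite nE {1}ME -!mulnA (mulnC (2 ^ f)%N).
Qed.

(** * Reduction to the parameter register *)

Lemma tensmx_suml (R : pzRingType) (m n p q : nat) (I : finType) (P : pred I)
    (A : I -> 'M[R]_(m, n)) (B : 'M[R]_(p, q)) :
  tensmx (\sum_(i | P i) A i) B = \sum_(i | P i) tensmx (A i) B.
Proof.
apply/matrixP=> i j; rewrite mxE !summxE mulr_suml.
by apply: eq_bigr => k _; rewrite mxE.
Qed.

Lemma tensmx_sumr (R : pzRingType) (m n p q : nat) (I : finType) (P : pred I)
    (A : 'M[R]_(m, n)) (B : I -> 'M[R]_(p, q)) :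
  tensmx A (\sum_(i | P i) B i) = \sum_(i | P i) tensmx A (B i).
Proof.
apply/matrixP=> i j; rewrite mxE !summxE mulr_sumr.
by apply: eq_bigr => k _; rewrite mxE.
Qed.

Lemma tensmxZl (R : pzRingType) (m n p q : nat) (a : R)
    (A : 'M[R]_(m, n)) (B : 'M[R]_(p, q)) : tensmx (a *: A) B = a *: tensmx A B.
Proof. by apply/matrixP=> i j; rewrite !mxE mulrA. Qed.

Lemma tensmxZr (R : comPzRingType) (m n p q : nat) (a : R)
    (A : 'M[R]_(m, n)) (B : 'M[R]_(p, q)) : tensmx A (a *: B) = a *: tensmx A B.
Proof. by apply/matrixP=> i j; rewrite !mxE mulrCA. Qed.

Lemma tensmx11 (R : pzRingType) (m n : nat) :
  tensmx 1%:M 1%:M = 1%:M :> 'M[R]_(m * n).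
Proof.
apply/matrixP=> i j; case: (mxtens_indexP i) => i1 i2; case: (mxtens_indexP j) => j1 j2.
rewrite tensmxE !mxE -natrM mulnb (inj_eq (can_inj (@mxtens_indexK _ _))).
by rewrite xpair_eqE.
Qed.

Lemma kron4_mul (R : realType) (a b c d a' b' c' d' a'' b'' c'' d'' : nat)
    (A : 'M[R[i]]_(a, a')) (B : 'M[R[i]]_(b, b')) (C : 'M[R[i]]_(c, c'))
    (D : 'M[R[i]]_(d, d')) (A' : 'M[R[i]]_(a', a'')) (B' : 'M[R[i]]_(b', b''))
    (C' : 'M[R[i]]_(c', c'')) (D' : 'M[R[i]]_(d', d'')) :
  kron4 A B C D *m kron4 A' B' C' D' =
  kron4 (A *m A') (B *m B') (C *m C') (D *m D').
Proof. by rewrite /kron4 !tensmx_mul. Qed.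

Lemma kron4_1 (R : realType) (a b c d : nat) :
  kron4 (1%:M : 'M[R[i]]_a) (1%:M : 'M[R[i]]_b) (1%:M : 'M[R[i]]_c)
    (1%:M : 'M[R[i]]_d) = 1%:M.
Proof. by rewrite /kron4 !tensmx11. Qed.

Lemma ket_proj (R : realType) (n : nat) (l : 'I_n) :
  ket R l *m (ket R l) ^t* = delta_mx l l.
Proof. by rewrite trmx_delta map_delta_mx mul_delta_mx. Qed.

Lemma sum_ket (R : realType) (n : nat) (v : 'cV[R[i]]_n) :
  v = \sum_j v j 0 *: ket R j.
Proof.
apply/colP => i; rewrite summxE (bigD1 i) //= big1 => [|j ji].
  by rewrite !mxE !eqxx mulr1 addr0.
by rewrite !mxE eq_sym (negPf ji) mulr0.
Qed.

Lemma sqnorm_tens (R : realType) (m n : nat) (u : 'cV[R[i]]_m) (v : 'cV[R[i]]_n) :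
  sqnorm (tensmx u v) = sqnorm u * sqnorm v.
Proof.
rewrite /sqnorm mulr_sum; apply: eq_bigr => s _.
by rewrite mxE normcM exprMn !(ord1 (mxtens_unindex _).1) !(ord1 (mxtens_unindex _).2).
Qed.

Lemma sqnorm_ket (R : realType) (n : nat) (i : 'I_n) : sqnorm (ket R i) = 1.
Proof.
rewrite /sqnorm (bigD1 i) //= big1 => [|j ji].
  by rewrite !mxE !eqxx normc1 expr1n addr0.
by rewrite !mxE (negPf ji) normc0 expr0n.
Qed.

Lemma sqnorm_kron4 (R : realType) (a b c d : nat) (u : 'cV[R[i]]_a)
    (v : 'cV[R[i]]_b) (w : 'cV[R[i]]_c) (z : 'cV[R[i]]_d) :
  sqnorm (kron4 u v w z) = sqnorm u * sqnorm v * sqnorm w * sqnorm z.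
Proof. by rewrite /kron4 !sqnorm_tens. Qed.

Lemma unitarymx_adjK (C : numClosedFieldType) (n : nat) (U : 'M[C]_n) :
  U \is unitarymx -> U ^t* *m U = 1%:M.
Proof. by move=> /unitarymxP/mulmx1C. Qed.

Lemma normc_real (R : realType) (x : R) : normc x%:C ^+ 2 = x ^+ 2.
Proof. by rewrite /= expr0n addr0 sqr_sqrtr // sqr_ge0. Qed.

Lemma card_notin (n : nat) (A : {set 'I_n}) : #|[pred j | j \notin A]| = (n - #|A|)%N.
Proof.
have := cardC A; rewrite card_ord => cardE.
by apply/(@addnI #|A|)/(etrans cardE); rewrite subnKC // (leq_trans (max_card _)) ?card_ord.
Qed.

(* The plane left invariant by the amplification iterate. *)
Definition two_level (R : realType) (n : nat) (MM : {set 'I_n}) (a b : R) :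
    'cV[R[i]]_n :=
  \col_j (if j \in MM then a else b)%:C.

Lemma sqnorm_two_level (R : realType) (n : nat) (MM : {set 'I_n}) (a b : R) :
  sqnorm (two_level MM a b) = #|MM|%:R * a ^+ 2 + (n - #|MM|)%N%:R * b ^+ 2.
Proof.
rewrite /sqnorm (bigID (mem MM)) /=; congr (_ + _).
  rewrite mulr_natl -sumr_const; apply: eq_bigr => j jM.
  by rewrite mxE jM normc_real.
rewrite -card_notin mulr_natl -sumr_const.
by apply: eq_bigr => j /negPf jM; rewrite mxE jM normc_real.
Qed.

(** * Phase oracle, inversion about the mean, and rotation of the amplitudes *)

Section Dynamics.
Variables (R : realType) (p : model R).

(** [Uc] writes |r| - tol into Z, whose sign is the predicate; the phase is a scalar, so the adjoint
    of [Uc] uncomputes Z and the ancilla whatever [phi] is. *)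
Lemma Schi_basis (i : 'I_(2 ^ nX p)) (j : 'I_(2 ^ nW p)) :
  Schi p *m kron4 (ket R i) (ket R j) (ket0 R (nZ p)) (ket0 R (nA p)) =
  (-1) ^+ chi i j *: kron4 (ket R i) (ket R j) (ket0 R (nZ p)) (ket0 R (nA p)).
Proof.
have [phi Uc_ij] := Uc_compute i j.
rewrite /Schi -!mulmxA Uc_ij kron4_mul !mul1mx.
have -> : SZ p *m ket R (kappa i j) = (-1) ^+ chi i j *: ket R (kappa i j).
  apply/colP => s; rewrite mul_diag_mx !mxE; have [->|_] := eqVneq s (kappa i j).
    by rewrite kappaP subr_lt0.
  by rewrite !mulr0.
rewrite {1}/kron4 tensmxZr tensmxZl -/(kron4 (ket R i) (ket R j) (ket R _) phi).
by rewrite -Uc_ij -scalemxAr mulmxA unitarymx_adjK ?Uc_unitary // mul1mx.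
Qed.

Variable MM : {set 'I_(2 ^ nW p)}.
Hypothesis chi_indep : forall i j, chi i j = (j \in MM).

Lemma marked_indep i : marked i = MM.
Proof. by apply/setP => j; rewrite inE chi_indep. Qed.

Let reflection : 'M[R[i]]_(2 ^ nW p) :=
  1%:M - 2 *: \sum_(j in MM) ket R j *m (ket R j) ^t*.

Lemma marked_proj_entry (v : 'cV_(2 ^ nW p)) j :
  ((\sum_(l in MM) ket R l *m (ket R l) ^t*) *m v) j 0 = (j \in MM)%:R * v j 0.
Proof.
have proj l : ((ket R l *m (ket R l) ^t*) *m v) j 0 = (l == j)%:R * v j 0.
  rewrite ket_proj mxE (bigD1 l) //= big1 => [|s sl].
    by rewrite !mxE eqxx andbT addr0 eq_sym; case: eqVneq => [->|_]; rewrite ?mul0r.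
  by rewrite mxE (negPf sl) andbF mul0r.
rewrite mulmx_suml summxE; under eq_bigr do rewrite proj.
have [jM|jM] := boolP (j \in MM).
  rewrite (bigD1 j) //= big1 => [|l /andP[_ /negPf ->]]; last by rewrite mul0r.
  by rewrite eqxx addr0.
rewrite big1 => [|l lM]; first by rewrite mul0r.
by case: eqVneq lM jM => [->->//|_]; rewrite mul0r.
Qed.

Lemma reflection_entry (v : 'cV_(2 ^ nW p)) j :
  (reflection *m v) j 0 = (-1) ^+ (j \in MM) * v j 0.
Proof.
rewrite mulmxBl mul1mx -scalemxAl mxE [X in _ + X]mxE [X in - X]mxE marked_proj_entry.
by case: (j \in MM) => /=; rewrite ?expr1 ?expr0; ring.
Qed.

(** The oracle is known only on basis states with Z and A at zero. Expanding linearly, its phases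
    depend on [j] alone, so the X factor survives intact; Z and A stay at zero, which lets the step
    be iterated. *)
Lemma Schi_product (v : 'cV_(2 ^ nW p)) :
  Schi p *m kron4 (PsiX p) v (ket0 R (nZ p)) (ket0 R (nA p)) =
  kron4 (PsiX p) (reflection *m v) (ket0 R (nZ p)) (ket0 R (nA p)).
Proof.
have expand (w : 'cV_(2 ^ nW p)) : kron4 (PsiX p) w (ket0 R (nZ p)) (ket0 R (nA p)) =
    \sum_i \sum_j (alpha i * w j 0) *:
      kron4 (ket R i) (ket R j) (ket0 R (nZ p)) (ket0 R (nA p)).
  rewrite {1}[w]sum_ket /kron4 /PsiX !tensmx_suml; apply: eq_bigr => i _.
  rewrite tensmx_sumr !tensmx_suml; apply: eq_bigr => j _.
  by rewrite tensmxZl tensmxZr scalerA !tensmxZl.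
rewrite !expand mulmx_sumr; apply: eq_bigr => i _.
rewrite mulmx_sumr; apply: eq_bigr => j _.
by rewrite -scalemxAr Schi_basis scalerA reflection_entry chi_indep mulrA mulrAC.
Qed.

Lemma amplified_product k :
  amplified p k =
  kron4 (PsiX p) (GM MM ^+ k *m PsiW p) (ket0 R (nZ p)) (ket0 R (nA p)).
Proof.
elim: k => [|k IH]; first by rewrite /amplified !expr0 !mul1mx.
rewrite /amplified [in LHS]exprS -mulmxE -mulmxA -/(amplified p k) IH.
rewrite /Giter -mulmxA Schi_product kron4_mul !mul1mx.
by rewrite [in RHS]exprS -mulmxE -[in RHS]mulmxA /GM -[in RHS]mulmxA.
Qed.

Lemma PsiW_entry j s : PsiW p j s = ((Num.sqrt (2 ^ nW p)%N%:R)^-1)%:C.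
Proof.
rewrite (ord1 s) mxE summxE (bigD1 j) //= big1 => [|l lj].
  by rewrite mxE !eqxx addr0 mulr1 fmorphV.
by rewrite mxE eq_sym (negPf lj).
Qed.

(** Inversion about the mean, in coordinates. *)
Lemma UPsiW_entry (u : 'cV_(2 ^ nW p)) j :
  (UPsiW p *m u) j 0 = 2 / (2 ^ nW p)%N%:R * \sum_l u l 0 - u j 0.
Proof.
rewrite mulmxBl mul1mx -scalemxAl -mulmxA !mxE big_ord1; congr (_ - _).
rewrite -mulrA; congr (_ * _); rewrite PsiW_entry mxE mulr_sumr [RHS]mulr_sumr.
apply: eq_bigr => l _; rewrite [(PsiW p ^t*) _ _]mxE [(PsiW p)^T _ _]mxE PsiW_entry mulrA.
congr (_ * _); rewrite [X in _ * X]conjc_real -rmorphM -invfM -expr2 sqr_sqrtr ?ler0n //.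
by rewrite fmorphV rmorph_nat.
Qed.

(** [mean] is twice the average amplitude once the marked entries have changed sign. *)
Lemma GM_two_level (a b : R) :
  let mean := 2 / (2 ^ nW p)%N%:R * ((2 ^ nW p - #|MM|)%N%:R * b - #|MM|%:R * a) in
  GM MM *m two_level MM a b = two_level MM (mean + a) (mean - b).
Proof.
move=> mean; apply/colP => j; rewrite /GM -mulmxA UPsiW_entry.
rewrite (_ : 2 / _ * _ = mean%:C); last first.
  rewrite /mean rmorphM fmorph_div !rmorph_nat; congr (_ * _).
  under eq_bigr do rewrite reflection_entry mxE.
  rewrite (bigID (mem MM)) /= addrC rmorphB; congr (_ + _).
    rewrite (eq_bigr (fun=> b%:C)) => [|l /negPf ->]; last by rewrite mul1r.
    rewrite sumr_const rmorphM rmorph_nat mulr_natl; congr (_ *+ _).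
    exact: card_notin.
  rewrite (eq_bigr (fun=> - a%:C)) => [|l ->]; last by rewrite mulN1r.
  by rewrite sumr_const rmorphM rmorph_nat mulr_natl mulNrn.
rewrite reflection_entry !mxE; case: (j \in MM).
  by rewrite expr1 mulN1r opprK -rmorphD.
by rewrite expr0 mul1r -rmorphB.
Qed.

Hypotheses (MM_gt0 : (0 < #|MM|)%N) (MM_lt : (#|MM| < 2 ^ nW p)%N).

Let th : R := asin (Num.sqrt (#|MM|%:R / (2 ^ nW p)%N%:R)).

(** Scaled by the square roots of the two class sizes, the amplitudes are the sine and cosine of one
    angle, and [GM_two_level] becomes the addition formulas for 2 [th]. *)
Lemma amplitude k : GM MM ^+ k *m PsiW p =
  two_level MM (sin ((2 * k + 1)%N%:R * th) / Num.sqrt #|MM|%:R)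
               (cos ((2 * k + 1)%N%:R * th) / Num.sqrt (2 ^ nW p - #|MM|)%N%:R).
Proof.
set x := Num.sqrt #|MM|%:R; set y := Num.sqrt (2 ^ nW p - #|MM|)%N%:R.
set z : R := Num.sqrt (2 ^ nW p)%N%:R.
have x0 : 0 < x by rewrite sqrtr_gt0 ltr0n.
have y0 : 0 < y by rewrite sqrtr_gt0 ltr0n subn_gt0.
have z0 : 0 < z by rewrite sqrtr_gt0 ltr0n expn_gt0.
have x2 : #|MM|%:R = x ^+ 2 by rewrite sqr_sqrtr ?ler0n.
have y2 : (2 ^ nW p - #|MM|)%N%:R = y ^+ 2 by rewrite sqr_sqrtr ?ler0n.
have z2 : (2 ^ nW p)%N%:R = z ^+ 2 by rewrite sqr_sqrtr ?ler0n.
have xyz : z ^+ 2 = x ^+ 2 + y ^+ 2.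
  by rewrite -x2 -y2 -z2 -natrD subnKC // ltnW.
have ratioE : Num.sqrt (#|MM|%:R / (2 ^ nW p)%N%:R) = x / z :> R.
  by rewrite sqrtrM ?ler0n // sqrtrV ?ler0n.
have ratio_itv : -1 <= x / z <= 1.
  apply/andP; split; first by apply: (le_trans (lerN10 _)); rewrite divr_ge0 ?ltW.
  by rewrite ler_pdivrMr // mul1r ler_wsqrtr // ler_nat ltnW.
have sin_th : sin th = x / z by rewrite /th ratioE asinK.
have cos_th : cos th = y / z.
  rewrite /th ratioE cos_asin // (_ : 1 - _ = (y / z) ^+ 2) ?sqrtr_sqr.
    by rewrite gtr0_norm // divr_gt0.
  by rewrite !expr_div_n xyz; field; rewrite -xyz gt_eqF // exprn_gt0.
elim: k => [|k IH].
  rewrite expr0 mul1mx mul1r sin_th cos_th; apply/colP => j.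
  rewrite PsiW_entry mxE -/z; congr (_%:C).
  by case: ifP => _; field; rewrite !gt_eqF.
rewrite exprS -mulmxE -mulmxA IH GM_two_level x2 y2 z2.
rewrite (_ : (2 * k.+1 + 1)%N%:R * th = (2 * k + 1)%N%:R * th + th *+ 2); last first.
  by rewrite mulnS -addnA natrD mulrDl [RHS]addrC mulr_natl.
rewrite (sinD _ (th *+ 2)) (cosD _ (th *+ 2)) sin_mulr2n cos_mulr2n sin_th cos_th.
move: (sin _) (cos _) => s c.
have cos2 : (y / z) ^+ 2 *+ 2 - 1 = (y ^+ 2 - x ^+ 2) / z ^+ 2.
  by rewrite expr_div_n xyz; field; rewrite -xyz gt_eqF // exprn_gt0.
have sincos : y / z * (x / z) = x * y / z ^+ 2 by field; rewrite gt_eqF.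
by rewrite cos2 sincos xyz; congr two_level; field; rewrite -xyz !gt_eqF // exprn_gt0.
Qed.

Lemma Psucc_const k : Psucc p k = sin ((2 * k + 1)%N%:R * th) ^+ 2.
Proof.
rewrite /Psucc /theta; under eq_bigr do rewrite marked_indep -/th.
rewrite -mulr_suml (_ : \sum_i _ = 1) ?mul1r // -(PsiX_unit p).
apply: eq_bigr => i _; rewrite /PsiX summxE (bigD1 i) //= big1 => [|l li].
  by rewrite !mxE !eqxx mulr1 addr0.
by rewrite !mxE eq_sym (negPf li) mulr0.
Qed.

(** Identifies [Psucc] with the measurement probability: the projector acts only on W, where it
    kills the unmarked amplitudes. *)
Lemma sqnorm_marked k : sqnorm (marked_projector p *m amplified p k) = Psucc p k.
Proof.
have projE : marked_projector p = kron4 (\sum_i ket R i *m (ket R i) ^t*)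
    (\sum_(j in MM) ket R j *m (ket R j) ^t*) 1%:M 1%:M.
  rewrite /kron4 !tensmx_suml; apply: eq_bigr => i _.
  by rewrite marked_indep tensmx_sumr !tensmx_suml.
have sum_proj : \sum_i ket R i *m (ket R i) ^t* = 1%:M :> 'M[R[i]]_(2 ^ nX p).
  by rewrite [RHS]mx1_sum_delta; apply: eq_bigr => i _; rewrite ket_proj.
have proj_two_level a b : (\sum_(j in MM) ket R j *m (ket R j) ^t*) *m
    two_level MM a b = two_level MM a 0.
  apply/colP => j; rewrite marked_proj_entry !mxE.
  by case: (j \in MM); rewrite ?mul1r ?mul0r.
have -> : marked_projector p *m amplified p k = kron4 (PsiX p)
    (two_level MM (sin ((2 * k + 1)%N%:R * th) / Num.sqrt #|MM|%:R) 0)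
    (ket0 R (nZ p)) (ket0 R (nA p)).
  rewrite projE amplified_product sum_proj amplitude.
  have := kron4_mul (1%:M : 'M[R[i]]_(2 ^ nX p)) (\sum_(j in MM) ket R j *m (ket R j) ^t*)
    (1%:M : 'M[R[i]]_(2 ^ nZ p)) (1%:M : 'M[R[i]]_(2 ^ nA p)) (PsiX p)
    (two_level MM (sin ((2 * k + 1)%N%:R * th) / Num.sqrt #|MM|%:R)
      (cos ((2 * k + 1)%N%:R * th) / Num.sqrt (2 ^ nW p - #|MM|)%N%:R))
    (ket0 R (nZ p)) (ket0 R (nA p)).
  by rewrite proj_two_level !mul1mx.
rewrite sqnorm_kron4 PsiX_unit !sqnorm_ket sqnorm_two_level Psucc_const.
rewrite expr_div_n sqr_sqrtr ?ler0n //; field.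
by rewrite pnatr_eq0 -lt0n.
Qed.

End Dynamics.

(** * Gate counts *)

Section Implementation.
Variables (R : realType) (p : model R).
Local Notation dim := (2 ^ nX p * 2 ^ nW p * 2 ^ nZ p * 2 ^ nA p)%N.

Lemma conj_supM (A B : 'M[R[i]]_dim) :
  conj_sup (A *m B) = conj_sup A *m conj_sup B.
Proof.
rewrite /conj_sup !mulmxA -[in RHS](mulmxA _ (kron4 _ _ _ _) (kron4 _ _ _ _)).
by rewrite kron4_mul !mul1mx (unitarymxP (UsupX_unitary p)) kron4_1 mulmx1.
Qed.

Lemma conj_sup1 : conj_sup (1%:M : 'M[R[i]]_dim) = 1%:M.
Proof.
by rewrite /conj_sup mulmx1 kron4_mul !mul1mx unitarymx_adjK ?UsupX_unitary // kron4_1.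
Qed.

Lemma conj_sup_diffusion : conj_sup (diffusion p) = diffusion p.
Proof.
rewrite /conj_sup /diffusion !kron4_mul !mul1mx !mulmx1.
by rewrite unitarymx_adjK ?UsupX_unitary.
Qed.

Lemma circuit_mx_cat (N : nat) (c c' : seq (gate R)) :
  circuit_mx N (c ++ c') = circuit_mx N c' *m circuit_mx N c.
Proof.
elim: c => [|e c IH] /=; first by rewrite mulmx1.
by rewrite IH mulmxA.
Qed.

(** Conjugation by [UsupX] is multiplicative and fixes the diffusion, which acts trivially on X.
    Conjugating each oracle thus conjugates the whole power of the iterate. *)
Lemma implements_amplification (orc dif : seq (gate R)) (k : nat) :
  implements orc (oracle p) -> implements dif (diffusion p) ->
  implements (amplification_circuit orc dif k) (conj_sup (Giter p ^+ k)).
Proof.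
move=> [orc_ok orcE] [dif_ok difE]; elim: k => [|k [IH_ok IH]].
  by split=> //; rewrite expr0 conj_sup1.
split; first by rewrite /amplification_circuit /= !all_cat orc_ok dif_ok.
rewrite /amplification_circuit /= !circuit_mx_cat IH orcE difE.
rewrite exprSr -mulmxE conj_supM; congr (_ *m _).
by rewrite /Giter conj_supM conj_sup_diffusion.
Qed.

Lemma size_amplification (orc dif : seq (gate R)) (k : nat) :
  size (amplification_circuit orc dif k) = (k * (size orc + size dif))%N.
Proof. by elim: k => [|k IH] //=; rewrite size_cat IH size_cat. Qed.

End Implementation.

(** * Asymptotic estimates and the arcsine near zero *)

Lemma bigO_mul_le (R : realType) (I : Type) (F : filter_on I) (a b g h : I -> R) :
  (forall t, 0 <= a t <= b t) -> g =O_F h ->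
  (fun t => a t * g t) =O_F (fun t => b t * h t).
Proof.
move=> ab /eqO_exP[c c0 gh]; apply/eqO_exP; exists c => //.
apply: filterS gh => t gh; have /andP[a0 ab_t] := ab t.
rewrite !normrM (ger0_norm a0) (ger0_norm (le_trans a0 ab_t)) mulrCA.
by apply: ler_pM.
Qed.

Lemma bigO_add (R : realType) (I : Type) (F : filter_on I) (f g h : I -> R) :
  f =O_F h -> g =O_F h -> (fun t => f t + g t) =O_F h.
Proof.
move=> /eqO_exP[c c0 fh] /eqO_exP[d d0 gh]; apply/eqO_exP.
exists (c + d); first exact: addr_gt0.
apply: filterS2 fh gh => t fh gh; rewrite mulrDl.
by apply: le_trans (ler_normD _ _) _; apply: lerD.
Qed.

(** By the mean value theorem, sin x = x cos c for some c. *)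
Lemma sin_le (R : realType) (x : R) : 0 <= x -> sin x <= x.
Proof.
move=> x0.
have [|c _] := @MVT_segment R sin cos 0 x x0 (fun y _ => is_derive_sin y).
  by apply: continuous_subspaceT => y; exact: continuous_sin.
rewrite sin0 !subr0 => ->; have := cos_le1 c; nra.
Qed.

Lemma asin0 (R : realType) : asin 0 = 0 :> R.
Proof.
have pi0 := pi_gt0 R.
by rewrite -{1}(sin0 R) sinK // in_itv /=; apply/andP; split; lra.
Qed.

(** This is [sin_le] at [asin x]; a negative arcsine would give [x] a negative sine value. *)
Lemma asin_ge (R : realType) (x : R) : 0 <= x <= 1 -> x <= asin x.
Proof.
move=> /andP[x0 x1].
have x_itv : -1 <= x <= 1 by rewrite x1 andbT (le_trans _ x0) ?lerN10.
have sin_asin : sin (asin x) = x by rewrite asinK.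
have [/sin_le|asin_lt0] := leP 0 (asin x); first by rewrite sin_asin.
have := asin_geNpi2 x_itv; have := pi_ge2 R => pi2 asin_ge.
have : 0 < sin (- asin x) by apply: sin_gt0_pi; apply/andP; split; lra.
by rewrite sinN sin_asin; lra.
Qed.

(** The arcsine has derivative 1 at 0; clearing the denominator of its difference quotient gives the
    required bound, pulled back along [s]. *)
Lemma asin_equiv (R : realType) (I : Type) (F : filter_on I) (s : I -> R) :
  s @ F --> (0 : R) -> (fun t => asin (s t)) ~_F s.
Proof.
move=> s0; apply/eqaddoP => e e0.
apply: (s0 (fun h => `|asin h - h| <= e * `|h|)).
have dasin : is_derive (0 : R) 1 (@asin R) 1.
  have : -1 < (0 : R) < 1 by rewrite ltrN10 ltr01.
  by move=> /is_derive1_asin; rewrite expr0n subr0 sqrtr1 invr1.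
have := @ex_derive _ _ _ _ _ _ _ dasin; rewrite /derivable -/(derive _ _ _).
rewrite (@derive_val _ _ _ _ _ _ _ dasin) => /cvgrPdist_le/(_ e e0).
rewrite near_withinE => asin_near; apply: filterS asin_near => h /= h_near.
have [->|h0] := eqVneq h 0; first by rewrite asin0 subr0 normr0 mulr0.
have := h_near h0; rewrite asin0 subr0 addr0 [h *: 1]mulr1.
rewrite -(ler_pM2r (_ : 0 < `|h|)) ?normr_gt0 // -normrM mulrBl mul1r.
by rewrite -[_ *: _]/(_ * _) mulrAC mulVf // mul1r distrC.
Qed.

Theorem corollary5p4 (R : realType) (I : Type) (F : filter_on I)
    (p : I -> model R)
    (MM : forall t : I, {set 'I_(2 ^ nW (p t))})
    (chi_indep : forall t i j, chi i j = (j \in MM t))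
    (M_gt0 : forall t, (0 < #|MM t|)%N)
    (M_ltNW : forall t, (#|MM t| < 2 ^ nW (p t))%N) :
  let ratio t : R := #|MM t|%:R / (2 ^ nW (p t))%N%:R in
  let th t : R := asin (Num.sqrt (ratio t)) in
  let first_cycle t := [set k : nat | (2 * k + 1)%N%:R * th t <= pi] in
  let T t : R := (oracle_bound (p t))%:R in
  (forall t,
    [/\ (forall i, marked i = MM t),
        (forall i, theta (p := p t) i = th t),
        (forall k, amplified (p t) k =
           kron4 (PsiX (p t)) (GM (MM t) ^+ k *m PsiW (p t))
                 (ket0 R (nZ (p t))) (ket0 R (nA (p t)))) &
        (forall k, sqnorm (marked_projector (p t) *m amplified (p t) k) =
           Psucc (p t) k)] /\
    (forall k, argmax_on (first_cycle t) (Psucc (p t)) k <->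
       nearest (pi / (4 * th t) - 2^-1) k) /\
    (argmax_on setT (Psucc (p t)) !=set0 ->
       forall k, nearest (pi / (4 * th t) - 2^-1) k ->
         argmax_on setT (Psucc (p t)) k)) /\
  (forall (kstar : I -> nat) (orc dif : I -> seq (gate R)),
    (forall t, argmax_on (first_cycle t) (Psucc (p t)) (kstar t)) ->
    (forall t, implements (orc t) (oracle (p t))) ->
    (forall t, implements (dif t) (diffusion (p t))) ->
    (fun t => (size (orc t))%:R : R) =O_F T ->
    let oracle_gates t : R := (kstar t * size (orc t))%N%:R in
    let C_quantum t : R :=
      (size (amplification_circuit (orc t) (dif t) (kstar t)))%:R in
    let lower_order := (fun t => (size (dif t))%:R : R) =O_F T in
    [/\ (forall t k, implements (amplification_circuit (orc t) (dif t) k)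
           (conj_sup (Giter (p t) ^+ k))),
        oracle_gates =O_F (fun t => (th t)^-1 * T t),
        (lower_order -> C_quantum =O_F (fun t => (th t)^-1 * T t)) &
        (ratio @ F --> (0 : R) ->
          [/\ th ~_F (fun t => Num.sqrt (ratio t)),
              oracle_gates =O_F (fun t => Num.sqrt ((2 ^ nW (p t))%N%:R / #|MM t|%:R) * T t) &
              (lower_order ->
                C_quantum =O_F (fun t => Num.sqrt ((2 ^ nW (p t))%N%:R / #|MM t|%:R) * T t))])]).

Proof.
move=> ratio th first_cycle T.
have NW_gt0 t : 0 < (2 ^ nW (p t))%N%:R :> R by rewrite ltr0n expn_gt0.
have ratio_gt0 t : 0 < ratio t by rewrite divr_gt0 // ltr0n.
have ratio_lt1 t : ratio t < 1 by rewrite ltr_pdivrMr // mul1r ltr_nat.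
have root_gt0 t : 0 < Num.sqrt (ratio t) by rewrite sqrtr_gt0.
have root_lt1 t : Num.sqrt (ratio t) < 1 by rewrite -[ltRHS]sqrtr1 ltr_sqrt.
have root_le_th t : Num.sqrt (ratio t) <= th t.
  by apply: asin_ge; apply/andP; split; apply: ltW.
have th_gt0 t : 0 < th t := lt_le_trans (root_gt0 t) (root_le_th t).
have th_itv t : 0 < th t < pi / 2.
  rewrite th_gt0 asin_ltpi2 // root_lt1 andbT.
  by apply: le_trans (ltW (root_gt0 t)); exact: lerN10.
have sin_th t : sin (th t) ^+ 2 = ratio t.
  rewrite asinK ?sqr_sqrtr ?ltW // in_itv /= (ltW (root_lt1 t)) andbT.
  by apply: le_trans (ltW (root_gt0 t)); exact: lerN10.
have PsuccE t : Psucc (p t) = fun k => sin ((2 * k + 1)%N%:R * th t) ^+ 2.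
  by apply/funext => k; exact: Psucc_const (chi_indep t) k.
split=> [t|kstar orc dif kstar_max orcP difP orc_O oracle_gates C_quantum lower_order].
  split.
    split=> [i|i|k|k].
    - exact: marked_indep (chi_indep t) i.
    - by rewrite /theta (marked_indep (chi_indep t)).
    - exact: amplified_product (chi_indep t) k.
    - exact: sqnorm_marked (chi_indep t) (M_gt0 t) (M_ltNW t) k.
  rewrite PsuccE; split=> [k|max_ne0 k]; first exact: argmax_first_cycle.
  (* Since the size of W is a power of 2, the squared sine is a dyadic fraction and can be
     reduced. *)
  have [s [g [s_odd s_lt sg]]] := odd_part (introT andP (conj (M_gt0 t) (M_ltNW t))).
  move=> /(argmax_first_cycle k (th_itv t)).
  apply: argmax_first_cycle_setT (th_itv t) s_odd s_lt _ max_ne0.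
  rewrite sin_th /ratio -natrX; apply/eqP.
  by rewrite eqr_div ?pnatr_eq0 -?lt0n ?expn_gt0 // -!natrM sg.
(* The rounding error 1/2 cancels the offset -1/2, leaving pi / (4 [th]), and pi < 4. *)
have kstar_le t : 0 <= ((kstar t)%:R : R) <= (th t)^-1.
  have := kstar_max t; rewrite PsuccE => /(argmax_first_cycle _ (th_itv t)).
  rewrite /nearest ler_norml ler0n => /andP[_ k_le] /=.
  have : (kstar t)%:R <= pi / (4 * th t) by lra.
  move=> /le_trans; apply; rewrite invfM mulrA ger_pMl ?invr_gt0 //.
  by have := pihalf_lt2 R; lra.
(* Inverts [root_le_th]: 1 / [th] is at most the inverse root of the ratio. *)
have kstar_le_root t : 0 <= ((kstar t)%:R : R) <= Num.sqrt ((2 ^ nW (p t))%N%:R / #|MM t|%:R).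
  have /andP[-> k_le] := kstar_le t; apply: (le_trans k_le).
  rewrite -invf_div sqrtrV; last exact: ltW (ratio_gt0 t).
  by rewrite -/(ratio t) lef_pV2 ?posrE //; exact: root_le_th.
have oracle_gatesE : oracle_gates = fun t => (kstar t)%:R * (size (orc t))%:R.
  by apply/funext => t; exact: natrM.
have C_quantumE : C_quantum =
    fun t => (kstar t)%:R * ((size (orc t))%:R + (size (dif t))%:R).
  by apply/funext => t; rewrite /C_quantum size_amplification natrM natrD.
split.
- by move=> t k; apply: implements_amplification.
- by rewrite oracle_gatesE; apply: bigO_mul_le orc_O.
- by move=> dif_O; rewrite C_quantumE; apply: bigO_mul_le (bigO_add orc_O dif_O).
move=> ratio0; split.
- apply: asin_equiv; rewrite -[X in _ --> X]sqrtr0.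
  by apply: cvg_comp ratio0 _; exact: sqrt_continuous.
- by rewrite oracle_gatesE; apply: bigO_mul_le orc_O.
- by move=> dif_O; rewrite C_quantumE; apply: bigO_mul_le (bigO_add orc_O dif_O).
Qed.
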